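(* Let $0\le a<b<\infty$, and let $f:[a,b]\to[0,\infty)$ be continuous on $[a,b]$ with $f\in L[a,b]$. Let $p,q>0$ be fixed. If $f$ is quasi-convex on $[a,b]$, then $$\int_a^b (x-a)^p(b-x)^q f(x)f(a+b-x)\,dx \le (b-a)^{p+q+1}\big(\max\{f(a),f(b)\}\big)^2\,\beta(p+1,q+1).$$
   Context: A function $f:I\to\mathbb{R}$ on an interval $I$ is quasi-convex if $f(\alpha x+(1-\alpha)y)\le\max(f(x),f(y))$ for all $x,y\in I$ and all $\alpha\in[0,1]$. $\beta(m,n)=\int_0^1 t^{m-1}(1-t)^{n-1}\,dt$ for $m,n>0$ is the Euler Beta function. $L[a,b]$ denotes the integrable functions on $[a,b]$. *)

(* Defs.v *)
From HB Require Import structures.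
From mathcomp Require Import all_boot all_order all_algebra.
From mathcomp Require Import all_classical all_reals all_analysis.

Set Implicit Arguments.
Unset Strict Implicit.
Unset Printing Implicit Defensive.

Import Order.TTheory GRing.Theory Num.Theory.
Import numFieldNormedType.Exports.

Local Open Scope classical_set_scope.
Local Open Scope ring_scope.

(* [f] is total on [R]; only its values on [I] matter. *)
Definition quasi_convex (R : realType) (I : interval R) (f : R -> R) : Prop :=
  forall x y alpha : R, x \in I -> y \in I -> 0 <= alpha <= 1 ->
    f (alpha * x + (1 - alpha) * y) <= Num.max (f x) (f y).

(* The library's [beta_fun] takes natural-number arguments only.  For [m, n > 0]
   the integral is finite, so [Rintegral] loses nothing; [powR 0 r] is total,
   and its value at the two endpoints does not affect the integral. *)
Definition Beta (R : realType) (m n : R) : R :=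
  \int[@lebesgue_measure R]_(t in `[0, 1]) (t `^ (m - 1) * (1 - t) `^ (n - 1)).

(* Main.v *)
(* Quasi-convexity bounds f on [a, b] by its larger endpoint value, hence also
   x |-> f (a + b - x); the affine substitution x = a + (b - a) t turns the
   integral of the remaining weight into a Beta integral. *)
Require Import Defs.
From HB Require Import structures.
From mathcomp Require Import all_boot all_order all_algebra.
From mathcomp Require Import all_classical all_reals all_analysis.
From mathcomp Require Import ring lra.

Set Implicit Arguments.
Unset Strict Implicit.
Unset Printing Implicit Defensive.

Import Order.TTheory GRing.Theory Num.Theory.
Import numFieldNormedType.Exports.

Local Open Scope classical_set_scope.
Local Open Scope ring_scope.

(* The norm is essential: powR takes the value 1 on negative bases, so
   [powR ^~ p] itself is discontinuous at 0. *)
Lemma continuous_norm_powR (R : realType) (p : R) : 0 < p ->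
  continuous (fun x : R => `|x| `^ p).
Proof.
move=> p0 x; have [->|x0] := eqVneq x 0.
  apply/cvgrPdist_lt => e e0; near=> y.
  rewrite normr0 powR0 ?gt_eqF// sub0r normrN ger0_norm ?powR_ge0//.
  have -> : e = (e `^ p^-1) `^ p by rewrite -powRrM mulVf ?gt_eqF// powRr1// ltW.
  apply: gt0_ltr_powR; rewrite ?nnegrE ?powR_ge0//.
  near: y.
  have := @nbhsx_ballx _ R 0 (e `^ p^-1) (powR_gt0 _ e0).
  by apply: filterS => y; rewrite /ball/= sub0r normrN.
apply: (@continuous_comp _ _ _ (fun y : R => `|y|) (@powR R ^~ p)).
  exact: norm_continuous.
apply/differentiable_continuous/derivable1_diffP/derivable_powR.
by rewrite in_itv/= andbT normr_gt0.
Unshelve. all: by end_near. Qed.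

(** Continuity on the whole line makes the weight integrable on every segment and fit for
    substitution; between [a] and [b] the absolute values change nothing. *)
Lemma continuous_norm_powRM (R : realType) (a b p q : R) : 0 < p -> 0 < q ->
  continuous (fun x : R => `|x - a| `^ p * `|b - x| `^ q).
Proof.
move=> p0 q0 x; apply: cvgM.
  apply: (@continuous_comp _ _ _ (fun y : R => y - a) (fun y => `|y| `^ p)).
    by apply: cvgB; [exact: cvg_id|exact: cvg_cst].
  exact: continuous_norm_powR.
apply: (@continuous_comp _ _ _ (fun y : R => b - y) (fun y => `|y| `^ q)).
  by apply: cvgB; [exact: cvg_cst|exact: cvg_id].
exact: continuous_norm_powR.
Qed.

(** Points of [A] near [x] land in [B], where the relative continuity of [g] applies. This serves
    the reflection of [[a, b]], since the function composed with it is continuous only relative to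
    [[a, b]]. *)
Lemma within_continuous_comp_subset (U V W : topologicalType)
    (A : set U) (B : set V) (f : U -> V) (g : V -> W) :
  f @` A `<=` B -> {within A, continuous f} -> {within B, continuous g} ->
  {within A, continuous (g \o f)}.
Proof.
rewrite !subspace_continuousP => fAB cf cg x Ax.
have Bfx : B (f x) by apply: fAB; exists x.
apply: cvg_comp (cg _ Bfx) => P /= BP.
have := cf _ Ax _ BP; rewrite /nbhs/= /within/= => AP.
near=> y => Ay.
suff: B (f y) by apply: (near AP y) => //; apply: AP.
by apply: fAB; exists y.
Unshelve. all: by end_near. Qed.

(** Under [x = a + (b - a) t] the two factors release [(b - a)]^ p[and](b - a) [^ q], and the
    Jacobian one more [b - a]. *)
Lemma integral_powR_Beta (R : realType) (a b p q : R) :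
  a < b -> 0 < p -> 0 < q ->
  \int[@lebesgue_measure R]_(x in `[a, b]) (`|x - a| `^ p * `|b - x| `^ q)
  = (b - a) `^ (p + q + 1) * Beta (p + 1) (q + 1).
Proof.
move=> ab p0 q0; have ba0 : 0 < b - a by rewrite subr_gt0.
(* The endpoints are parameters, so that [w a b] and the Beta integrand [w 0 1] are instances of one
   family. *)
pose w (c d x : R) := `|x - c| `^ p * `|d - x| `^ q.
have cw c d : continuous (w c d) by exact: continuous_norm_powRM.
pose F (t : R) := a + (b - a) * t.
have dF (x : R) : is_derive x 1 F (b - a).
  rewrite /F; apply: is_derive_eq.
  by rewrite add0r mul1r /GRing.scale/= mulr1.
have F'E : derive1 F = cst (b - a) by apply/funext => x; rewrite derive1E derive_val.
have cF : continuous F.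
  by move=> x; apply/differentiable_continuous/derivable1_diffP.
have F0 : F 0 = a by rewrite /F mulr0 addr0.
have F1 : F 1 = b by rewrite /F mulr1 addrC subrK.
have iw01 : (@lebesgue_measure R).-integrable `[0, 1] (EFin \o w 0 1).
  apply: continuous_compact_integrable; first exact: segment_compact.
  exact: continuous_subspaceT.
have -> : Beta (p + 1) (q + 1) =
    \int[@lebesgue_measure R]_(t in `[0, 1]) w 0 1 t.
  apply: eq_Rintegral => t; rewrite inE/= in_itv/= => /andP[t0 t1].
  by rewrite /w !addrK subr0 !ger0_norm ?subr_ge0.
rewrite -RintegralZl//; congr fine.
have := @integration_by_substitution_increasing R F (w a b) 0 1 ler01.
rewrite F0 F1 => ->//.
- apply: eq_integral => t; rewrite inE/= in_itv/= => /andP[t0 t1].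
  congr EFin; rewrite /= !fctE F'E /w /F /= subr0.
  have -> : a + (b - a) * t - a = (b - a) * t by ring.
  have -> : b - (a + (b - a) * t) = (b - a) * (1 - t) by ring.
  rewrite !normrM (gtr0_norm ba0) !powRM//; [|exact: ltW..].
  have ban0 : b - a != 0 by rewrite gt_eqF.
  rewrite !powRD ?ban0 ?implybT// powRr1 ?ltW//; ring.
- by move=> x y _ _ xy; rewrite /F ltrD2l ltr_pM2l.
- by rewrite F'E => ? _; exact: cvg_cst.
- by rewrite F'E; exact: is_cvg_cst.
- by rewrite F'E; exact: is_cvg_cst.
- split => //.
  + by apply: cvg_at_right_filter; exact: cF.
  + by apply: cvg_at_left_filter; exact: cF.
- exact: continuous_subspaceT.
Qed.

Lemma quasi_convex_le_max (R : realType) (a b : R) (f : R -> R) :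
  a < b -> quasi_convex `[a, b] f ->
  forall x, x \in `[a, b] -> f x <= Num.max (f a) (f b).
Proof.
move=> ab fqc x; rewrite in_itv/= => /andP[ax xb].
have ba0 : 0 < b - a by rewrite subr_gt0.
(* The barycentric weight of [x] relative to the endpoints serves as [alpha]. *)
have -> : x = (b - x) / (b - a) * a + (1 - (b - x) / (b - a)) * b.
  by field; rewrite gt_eqF.
apply: fqc; rewrite ?in_itv/= ?lexx ?(ltW ab)//.
by rewrite divr_ge0 ?subr_ge0 ?(ltW ab)//= ler_pdivrMr// mul1r lerD2l lerN2.
Qed.

Theorem theorem2 (R : realType) (a b p q : R) (f : R -> R)
  (ha : 0 <= a) (hab : a < b)
  (hf0 : forall x : R, x \in `[a, b] -> 0 <= f x)
  (hfc : {within `[a, b], continuous f})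
  (hfi : (@lebesgue_measure R).-integrable `[a, b] (EFin \o f))
  (hp : 0 < p) (hq : 0 < q)
  (hfq : quasi_convex `[a, b] f) :
  \int[@lebesgue_measure R]_(x in `[a, b])
      ((x - a) `^ p * (b - x) `^ q * f x * f (a + b - x))
    <= (b - a) `^ (p + q + 1) * (Num.max (f a) (f b)) ^+ 2
       * Beta (p + 1) (q + 1).
Proof.
set M := Num.max _ _.
pose w (x : R) := `|x - a| `^ p * `|b - x| `^ q.
have wE x : x \in `[a, b] -> (x - a) `^ p * (b - x) `^ q = w x.
  by rewrite in_itv/= => /andP[ax xb]; rewrite /w !ger0_norm ?subr_ge0.
have cw : {within `[a, b], continuous w}.
  by apply: continuous_subspaceT; exact: continuous_norm_powRM.
have rab x : x \in `[a, b] -> a + b - x \in `[a, b].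
  by rewrite !in_itv/= => /andP[ax xb]; apply/andP; split; lra.
have cfr : {within `[a, b], continuous (fun x => f (a + b - x))}.
  apply: (@within_continuous_comp_subset _ _ _ _ `[a, b] (fun x => a + b - x)) => //.
    by move=> _ [x xab <-]; exact: rab.
  apply: continuous_subspaceT => x.
  by apply: cvgB; [exact: cvg_cst|exact: cvg_id].
have iw : (@lebesgue_measure R).-integrable `[a, b] (EFin \o w).
  by apply: continuous_compact_integrable => //; exact: segment_compact.
(* Once the bound is an integral over the same segment, a pointwise comparison of integrands
   suffices. *)
have -> : (b - a) `^ (p + q + 1) * M ^+ 2 * Beta (p + 1) (q + 1) =
    \int[@lebesgue_measure R]_(x in `[a, b]) (M ^+ 2 * w x).
  rewrite RintegralZl// integral_powR_Beta//; ring.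
have -> : \int[@lebesgue_measure R]_(x in `[a, b])
      ((x - a) `^ p * (b - x) `^ q * f x * f (a + b - x)) =
    \int[@lebesgue_measure R]_(x in `[a, b]) (w x * f x * f (a + b - x)).
  by apply: eq_Rintegral => x; rewrite inE => xab; rewrite wE.
apply: le_Rintegral => //.
- apply: continuous_compact_integrable; first exact: segment_compact.
  by move=> x; apply: cvgM; [apply: cvgM; [exact: cw|exact: hfc]|exact: cfr].
- apply: continuous_compact_integrable; first exact: segment_compact.
  by move=> x; apply: cvgM; [exact: cvg_cst|exact: cw].
- move=> x xab; have fM := quasi_convex_le_max hab hfq.
  rewrite -mulrA mulrC ler_wpM2r ?mulr_ge0 ?powR_ge0//.
  (* Both [f x] and [f (a + b - x)] lie between 0 and [M], so their product is at most [M ^+ 2]. *)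
  by rewrite expr2 ler_pM ?hf0 ?fM ?rab.
Qed.
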